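(* Let $V$ be a 2-dimensional Gelfand--Dorfman algebra over a field $\Bbbk$. Then $V$ is special.
   Context: All algebras are over a field $\Bbbk$. A Gelfand--Dorfman algebra (GD-algebra) is a linear space $V$ with two bilinear operations $\circ$ and $[\cdot,\cdot]$ such that: (i) $(V,\circ)$ is a Novikov algebra, i.e. $(a\circ b)\circ c-a\circ(b\circ c)=(b\circ a)\circ c-b\circ(a\circ c)$ and $(a\circ b)\circ c=(a\circ c)\circ b$ for all $a,b,c\in V$; (ii) $(V,[\cdot,\cdot])$ is a Lie algebra; (iii) $b\circ[a,c]=[a,b\circ c]-[c,b\circ a]+[b,a]\circ c-[b,c]\circ a$ for all $a,b,c\in V$. A differential Poisson algebra is a Poisson algebra $(P,\cdot,\{\cdot,\cdot\})$ ($(P,\cdot)$ is associative and commutative, $(P,\{\cdot,\cdot\})$ is a Lie algebra, and $\{x,yz\}=y\{x,z\}+z\{x,y\}$) with a linear map $d:P\to P$ that is a derivation with respect to both operations: $d(xy)=x\,d(y)+d(x)\,y$ and $d\{x,y\}=\{d(x),y\}+\{x,d(y)\}$. Given such $P$, the space $P$ with operations $x\circ y=x\,d(y)$, $[x,y]=\{x,y\}$ is a GD-algebra, denoted $P^{(d)}$. A GD-algebra $V$ is special if there exist a differential Poisson algebra $P$ with derivation $d$ and an injective homomorphism of GD-algebras $V\to P^{(d)}$. *)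

(* Defs.v *)
From HB Require Import structures.
From mathcomp Require Import all_boot all_order all_algebra.
From mathcomp Require Import sesquilinear.
Set Implicit Arguments.
Unset Strict Implicit.
Unset Printing Implicit Defensive.
Import GRing.Theory.
Local Open Scope ring_scope.

Definition is_novikov (k : fieldType) (V : lmodType k)
    (circ : {bilinear V -> V -> V}) : Prop :=
  (forall a b c, circ (circ a b) c - circ a (circ b c) =
                 circ (circ b a) c - circ b (circ a c))
  /\ (forall a b c, circ (circ a b) c = circ (circ a c) b).

(* Alternating rather than merely antisymmetric: the field may have
   characteristic 2. *)
Definition is_lie (k : fieldType) (V : lmodType k)
    (br : {bilinear V -> V -> V}) : Prop :=
  (forall a, br a a = 0)
  /\ (forall a b c, br a (br b c) + br b (br c a) + br c (br a b) = 0).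

Record gd_algebra (k : fieldType) (V : lmodType k) := GDAlgebra {
  gd_circ : {bilinear V -> V -> V};
  gd_br : {bilinear V -> V -> V};
  gd_novikov : is_novikov gd_circ;
  gd_lie : is_lie gd_br;
  gd_compat : forall a b c,
    gd_circ b (gd_br a c) =
      gd_br a (gd_circ b c) - gd_br c (gd_circ b a)
      + gd_circ (gd_br b a) c - gd_circ (gd_br b c) a
}.

(* The associative commutative product is not assumed to have a unit, hence a
   bilinear map on an lmodType and not an instance of comAlgType. *)
Record diff_poisson (k : fieldType) (P : lmodType k) := DiffPoisson {
  dp_mul : {bilinear P -> P -> P};
  dp_br : {bilinear P -> P -> P};
  dp_der : {linear P -> P};
  dp_mulA : associative dp_mul;
  dp_mulC : commutative dp_mul;
  dp_lie : is_lie dp_br;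
  dp_leibniz : forall x y z,
    dp_br x (dp_mul y z) = dp_mul y (dp_br x z) + dp_mul z (dp_br x y);
  dp_der_mul : forall x y,
    dp_der (dp_mul x y) = dp_mul x (dp_der y) + dp_mul (dp_der x) y;
  dp_der_br : forall x y,
    dp_der (dp_br x y) = dp_br (dp_der x) y + dp_br x (dp_der y)
}.

Section GDOfDiffPoisson.
Variables (k : fieldType) (P : lmodType k) (D : diff_poisson P).

Definition dp_circ (x y : P) : P := dp_mul D x (dp_der D y).

Fact dp_circ_is_bilinear :
  bilinear_for (GRing.Scale.Law.clone _ _ ( *:%R ) _)
               (GRing.Scale.Law.clone _ _ ( *:%R ) _) dp_circ.
Proof.
split=> z a x y; rewrite /dp_circ.
- exact: linearPl.
- by rewrite linearP linearPr.
Qed.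

HB.instance Definition _ :=
  bilinear_isBilinear.Build k P P P _ _ dp_circ dp_circ_is_bilinear.

Fact dp_br_anti x y : dp_br D x y = - dp_br D y x.
Proof.
have [alt _] := dp_lie D; apply/eqP; rewrite -addr_eq0; apply/eqP.
by have := alt (x + y); rewrite linearDl !linearDr /= !alt add0r addr0 addrC.
Qed.

Fact dp_circ_novikov : is_novikov dp_circ.
Proof.
split=> a b c; rewrite /= /dp_circ; last first.
  by rewrite -!dp_mulA (dp_mulC D (dp_der D b)).
have subK (x y : P) : x - (y + x) = - y by rewrite opprD addrCA subrr addr0.
by rewrite !dp_der_mul !linearDr /= !dp_mulA !subK (dp_mulC D b a).
Qed.

Fact dp_circ_compat a b c :
  dp_circ b (dp_br D a c) =
    dp_br D a (dp_circ b c) - dp_br D c (dp_circ b a)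
    + dp_circ (dp_br D b a) c - dp_circ (dp_br D b c) a.
Proof.
rewrite /dp_circ !dp_leibniz dp_der_br linearDr /=.
rewrite (dp_br_anti b a) (dp_br_anti b c) !linearNl /= opprK.
rewrite (dp_br_anti c (dp_der D a)) linearNr /= opprD opprK.
rewrite !(dp_mulC D (dp_br D _ _)) addrA addrAC.
rewrite -!addrA; set x := dp_mul D b _; set y := dp_mul D b _.
set u := dp_mul D _ _; set v := dp_mul D _ _.
by rewrite [y + _]addrC (addrCA (- v)) (addrC (- u)) addKr (addrCA u) subrr addr0.
Qed.

Definition gd_of_diff_poisson : gd_algebra P :=
  @GDAlgebra k P dp_circ (dp_br D) dp_circ_novikov (dp_lie D) dp_circ_compat.

End GDOfDiffPoisson.

Definition is_gd_hom (k : fieldType) (V W : lmodType k)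
    (A : gd_algebra V) (B : gd_algebra W) (f : {linear V -> W}) : Prop :=
  (forall x y, f (gd_circ A x y) = gd_circ B (f x) (f y))
  /\ (forall x y, f (gd_br A x y) = gd_br B (f x) (f y)).

Definition special (k : fieldType) (V : lmodType k) (A : gd_algebra V) : Prop :=
  exists (P : lmodType k) (D : diff_poisson P) (f : {linear V -> P}),
    is_gd_hom A (gd_of_diff_poisson D) f /\ injective f.

(* Main.v *)
(* Every two-dimensional Gelfand-Dorfman algebra can be written as V = C e,
   where C = k[T] / (T^2 - al T - be), with operations
     (x e) o (y e) = x (d y + s y) e,   [x e, y e] = (D x * y - x * D y) e
   for an element s and two commuting derivations d, D of C.  Indeed, if some
   right multiplication R_v is not a scalar, it plays the role of T: right
   commutativity makes all right multiplications elements of C, left symmetry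
   makes d a derivation, and the compatibility axiom gives the statements on D.
   If all right multiplications are scalars, take T^2 = 0, with T e spanning a
   line killed by them that contains [V, V].

   Such an algebra embeds, by x e |-> x t, into C (x) k(t) with the derivation
   s d/dt + t^-1 d and the Poisson bracket {F, G} = D F * G_t - F_t * D G. *)
Require Import Defs.
From HB Require Import structures.
From mathcomp Require Import all_boot all_order all_algebra.
From mathcomp Require Import sesquilinear generic_quotient.
From mathcomp Require Import ring.
Set Implicit Arguments.
Unset Strict Implicit.
Unset Printing Implicit Defensive.
Import GRing.Theory.
Local Open Scope ring_scope.

(** * Differentiation of rational functions in one variable *)

Local Notation "x %:F" := (@FracField.tofrac _ x).

(** Independence of the quotient rule from the representative of n/d = m/e: the last hypothesis is
    the derivative of the cross relation n e = m d. *)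
Lemma quotient_rule_congr (K : fieldType) (n d m e n' d' m' e' : K) :
    d != 0 -> e != 0 -> n * e = m * d -> n' * e + n * e' = m' * d + m * d' ->
  (m' * e - m * e') / e ^+ 2 = (n' * d - n * d') / d ^+ 2.
Proof.
move=> d0 e0 H H'.
apply/eqP; rewrite eqr_div ?expf_neq0 //; apply/eqP.
have -> : (m' * e - m * e') * d ^+ 2 =
    (m' * d + m * d') * (d * e) - (m * d) * (e * d' + e' * d) by ring.
by rewrite -H' -H; ring.
Qed.

Lemma quotient_ruleD (K : fieldType) (n d m e n' d' m' e' : K) :
    d != 0 -> e != 0 ->
  ((n' * e + n * e' + (m' * d + m * d')) * (d * e)
    - (n * e + m * d) * (d' * e + d * e')) / (d * e) ^+ 2 =
  (n' * d - n * d') / d ^+ 2 + (m' * e - m * e') / e ^+ 2.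
Proof. by move=> d0 e0; field; rewrite d0 e0. Qed.

Lemma quotient_ruleM (K : fieldType) (n d m e n' d' m' e' : K) :
    d != 0 -> e != 0 ->
  ((n' * m + n * m') * (d * e) - (n * m) * (d' * e + d * e')) / (d * e) ^+ 2 =
  (n' * d - n * d') / d ^+ 2 * (m / e) + (n / d) * ((m' * e - m * e') / e ^+ 2).
Proof. by move=> d0 e0; field; rewrite d0 e0. Qed.

Section RationalFunctions.
Variable k : fieldType.
Local Notation F := {fraction {poly k}}.

Lemma frac_repr (x : F) : x = (\n_(repr x))%:F / (\d_(repr x))%:F.
Proof.
have d0 := denom_ratioP (repr x).
apply: (canRL (mulfK _)); first by rewrite tofrac_eq0.
(* Passing to classes of pairs turns the claim into a cross-multiplication. *)
rewrite -{1}[x]reprK; unlock FracField.tofrac.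
rewrite -[LHS]FracField.pi_mul; apply/eqmodP.
by rewrite /= /FracField.equivf /FracField.mulf !numden_Ratio
  ?mulr1 ?oner_eq0 // mulrC.
Qed.

(** The quotient rule on the representative picked by [repr]; [frac_der_div] shows that any other
    fraction gives the same value. *)
Definition frac_der (x : F) : F :=
  let n := \n_(repr x) in let d := \d_(repr x) in
  (n^`()%:F * d%:F - n%:F * d^`()%:F) / d%:F ^+ 2.

Lemma frac_der_div (n d : {poly k}) : d != 0 ->
  frac_der (n%:F / d%:F) = (n^`()%:F * d%:F - n%:F * d^`()%:F) / d%:F ^+ 2.
Proof.
move=> d0; have dF : d%:F != 0 by rewrite tofrac_eq0.
rewrite /frac_der; have := frac_repr (n%:F / d%:F).
move: (denom_ratioP (repr (n%:F / d%:F))).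
move: (\n_(repr (n%:F / d%:F))) (\d_(repr (n%:F / d%:F))) => m e e0.
have eF : e%:F != 0 by rewrite tofrac_eq0.
move=> /eqP; rewrite (eqr_div _ _ dF eF) => /eqP xE.
(* Injectivity of [tofrac] brings the cross relation back to polynomials, where it can be
   differentiated. *)
have cross : n * e = m * d by apply/eqP; rewrite -tofrac_eq !rmorphM; apply/eqP.
have cross' := congr1 (fun p => p^`()) cross; rewrite /= !derivM in cross'.
apply: (quotient_rule_congr dF eF xE).
have := congr1 (@FracField.tofrac _) cross'.
by rewrite !rmorphD !rmorphM.
Qed.

Lemma frac_derD x y : frac_der (x + y) = frac_der x + frac_der y.
Proof.
rewrite [x]frac_repr [y]frac_repr.
have /= := denom_ratioP (repr x); have /= := denom_ratioP (repr y).
move: (\n_(repr x)) (\n_(repr y)) (\d_(repr x)) (\d_(repr y)) => m n d e e0 d0.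
have dF : d%:F != 0 by rewrite tofrac_eq0.
have eF : e%:F != 0 by rewrite tofrac_eq0.
rewrite (addf_div _ _ dF eF) -!tofracM -tofracD.
rewrite (frac_der_div _ d0) (frac_der_div _ e0)
  (frac_der_div _ (mulf_neq0 d0 e0)).
rewrite derivD !derivM !(tofracD, tofracM).
exact: (quotient_ruleD _ _ _ _ _ _ dF eF).
Qed.

Lemma frac_derM x y : frac_der (x * y) = frac_der x * y + x * frac_der y.
Proof.
rewrite [x]frac_repr [y]frac_repr.
have /= := denom_ratioP (repr x); have /= := denom_ratioP (repr y).
move: (\n_(repr x)) (\n_(repr y)) (\d_(repr x)) (\d_(repr y)) => m n d e e0 d0.
have dF : d%:F != 0 by rewrite tofrac_eq0.
have eF : e%:F != 0 by rewrite tofrac_eq0.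
rewrite mulf_div -!tofracM.
rewrite (frac_der_div _ d0) (frac_der_div _ e0)
  (frac_der_div _ (mulf_neq0 d0 e0)).
rewrite !derivM !(tofracD, tofracM).
exact: (quotient_ruleM _ _ _ _ _ _ dF eF).
Qed.

Lemma frac_der_poly (p : {poly k}) : frac_der p%:F = (p^`())%:F.
Proof.
have := @frac_der_div p 1 (oner_neq0 _).
by rewrite derivC tofrac1 tofrac0 mulr1 mulr0 subr0 expr1n !divr1.
Qed.

End RationalFunctions.

(** * Differential Poisson algebras built from commuting derivations *)

Definition scalar_restr (k : fieldType) (P : comNzRingType)
  (iota : {rmorphism k -> P}) : Type := P.

Section PoissonFromDerivations.
Variables (k : fieldType) (P : comNzRingType) (iota : {rmorphism k -> P}).
Local Notation scalar_restr := (scalar_restr iota).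

HB.instance Definition _ := GRing.ComNzRing.on scalar_restr.

Definition restr_scale (a : k) (x : scalar_restr) : scalar_restr := iota a * x.

Fact restr_scaleA a b x :
  restr_scale a (restr_scale b x) = restr_scale (a * b) x.
Proof. by rewrite /restr_scale rmorphM mulrA. Qed.

Fact restr_scale1 : left_id 1 restr_scale.
Proof. by move=> x; rewrite /restr_scale rmorph1 mul1r. Qed.

Fact restr_scaleDr : right_distributive restr_scale +%R.
Proof. by move=> a x y; rewrite /restr_scale mulrDr. Qed.

Fact restr_scaleDl x : {morph restr_scale^~ x : a b / a + b}.
Proof. by move=> a b; rewrite /restr_scale rmorphD mulrDl. Qed.

HB.instance Definition _ := GRing.Zmodule_isLmodule.Build k scalar_restr
  restr_scaleA restr_scale1 restr_scaleDr restr_scaleDl.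

Lemma restr_scaleE (a : k) (x : scalar_restr) : a *: x = iota a * x :> P.
Proof. by []. Qed.

(** Vanishing on the image of [iota], together with the Leibniz rule, makes such a map
    $k$-linear. *)
Definition is_derivation (dl : P -> P) : Prop :=
  [/\ {morph dl : x y / x + y},
      forall x y, dl (x * y) = x * dl y + dl x * y
    & forall a, dl (iota a) = 0].

(** Abstract setting of the embedding: [dt] is d/dt, [d] and [del] are coefficient derivations with
    d ∧ del = 0, [s] is constant in t, and [u] stands for 1/t, whence dt u = - u^2. *)
Variables (dt d del : P -> P) (s u : P).
Hypotheses (dtP : is_derivation dt) (dP : is_derivation d)
  (delP : is_derivation del).
Hypotheses (dt_d : forall x, dt (d x) = d (dt x))
  (dt_del : forall x, dt (del x) = del (dt x))
  (d_del : forall x, d (del x) = del (d x))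
  (d_del_wedge : forall x y, d x * del y = d y * del x).
Hypotheses (dt_s : dt s = 0) (dt_u : dt u = - u ^+ 2) (del_u : del u = 0).

Definition der_mul (x y : scalar_restr) : scalar_restr := x * y.
Definition der_br (x y : scalar_restr) : scalar_restr :=
  del x * dt y - dt x * del y.
Definition der_der (x : scalar_restr) : scalar_restr := s * dt x + u * d x.

Lemma derivationN dl : is_derivation dl -> {morph dl : x / - x}.
Proof.
case=> dlD _ _ x; have dl0 : dl 0 = 0.
  by apply: (addrI (dl 0)); rewrite -dlD !addr0.
by apply: (addrI (dl x)); rewrite -dlD !subrr.
Qed.

Let derE :=
  (let: And3 D M C := dtP in (D, M, C), let: And3 D M C := dP in (D, M, C),
   let: And3 D M C := delP in (D, M, C),
   derivationN dtP, derivationN dP, derivationN delP,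
   dt_d, dt_del, d_del).

Fact der_mul_bilinear :
  bilinear_for (GRing.Scale.Law.clone _ _ ( *:%R ) _)
               (GRing.Scale.Law.clone _ _ ( *:%R ) _) der_mul.
Proof. by split=> z a x y; rewrite /der_mul /= !restr_scaleE; ring. Qed.

HB.instance Definition _ :=
  bilinear_isBilinear.Build k _ _ _ _ _ der_mul der_mul_bilinear.

Fact der_br_bilinear :
  bilinear_for (GRing.Scale.Law.clone _ _ ( *:%R ) _)
               (GRing.Scale.Law.clone _ _ ( *:%R ) _) der_br.
Proof. by split=> z a x y; rewrite /der_br /= !restr_scaleE !derE; ring. Qed.

HB.instance Definition _ :=
  bilinear_isBilinear.Build k _ _ _ _ _ der_br der_br_bilinear.

Fact der_der_linear : linear der_der.
Proof. by move=> a x y; rewrite /der_der !restr_scaleE !derE; ring. Qed.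

HB.instance Definition _ :=
  GRing.isLinear.Build k _ _ _ der_der der_der_linear.

Fact der_mulA : associative der_mul.
Proof. exact: mulrA. Qed.

Fact der_mulC : commutative der_mul.
Proof. exact: mulrC. Qed.

(** The bracket is the bivector del ∧ dt; since the two derivations commute, the second-order terms
    of the Jacobi sum cancel. *)
Fact der_br_lie : is_lie der_br.
Proof.
split=> [a|a b c] /=; rewrite /der_br; first by rewrite mulrC subrr.
by rewrite !derE; ring.
Qed.

Fact der_leibniz x y z :
  der_br x (der_mul y z) = der_mul y (der_br x z) + der_mul z (der_br x y).
Proof. by rewrite /der_br /der_mul !derE; ring. Qed.

Fact der_der_mul x y :
  der_der (der_mul x y) = der_mul x (der_der y) + der_mul (der_der x) y.
Proof. by rewrite /der_der /der_mul !derE; ring. Qed.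

Fact der_der_br x y :
  der_der (der_br x y) = der_br (der_der x) y + der_br x (der_der y).
Proof.
rewrite /der_der /der_br !derE dt_s dt_u del_u.
apply/eqP; rewrite -subr_eq0; apply/eqP.
(* Lie derivative of del ∧ dt along s dt + u d: the commutator with [del] is a multiple of [dt] and
   dies in the wedge, the one with [dt] is u^2 d, so only u^2 times del ∧ d is left. *)
transitivity (u ^+ 2 * (d y * del x - d x * del y)); first by ring.
by rewrite d_del_wedge subrr mulr0.
Qed.

Definition der_diff_poisson : diff_poisson scalar_restr :=
  @DiffPoisson k scalar_restr der_mul der_br der_der der_mulA der_mulC
    der_br_lie der_leibniz der_der_mul der_der_br.

End PoissonFromDerivations.

(** * Quadratic extensions and their derivations *)

(* The pair (x, y) stands for x + y T in F[T] / (T^2 - al T - be). *)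
Definition quad (F : comNzRingType) (al be : F) : Type := (F * F)%type.

Section QuadraticExtension.
Variables (F : comNzRingType) (al be : F).
Local Notation quad := (quad al be).
HB.instance Definition _ := GRing.Zmodule.on quad.

Definition quad_one : quad := (1, 0).
Definition quad_mul (x y : quad) : quad :=
  (x.1 * y.1 + be * x.2 * y.2, x.1 * y.2 + x.2 * y.1 + al * x.2 * y.2).

Fact quad_mulA : associative quad_mul.
Proof. by move=> x y z; congr pair => /=; ring. Qed.

Fact quad_mulC : commutative quad_mul.
Proof. by move=> x y; congr pair => /=; ring. Qed.

Fact quad_mul1 : left_id quad_one quad_mul.
Proof. by case=> x y; congr pair => /=; ring. Qed.

Fact quad_mulDl : left_distributive quad_mul +%R.
Proof. by move=> x y z; congr pair => /=; ring. Qed.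

Fact quad_one_neq0 : quad_one != 0.
Proof. by apply/eqP => -[/eqP]; rewrite oner_eq0. Qed.

HB.instance Definition _ := GRing.Zmodule_isComNzRing.Build quad
  quad_mulA quad_mulC quad_mul1 quad_mulDl quad_one_neq0.

Definition quad_const (x : F) : quad := (x, 0).

Fact quad_const_zmod : zmod_morphism quad_const.
Proof. by move=> x y; congr pair; rewrite /= subr0. Qed.

Fact quad_const_monoid : monoid_morphism quad_const.
Proof. by split=> // x y; congr pair => /=; ring. Qed.

HB.instance Definition _ :=
  GRing.isZmodMorphism.Build F quad quad_const quad_const_zmod.
HB.instance Definition _ :=
  GRing.isMonoidMorphism.Build F quad quad_const quad_const_monoid.

(* The F-linear map sending 1 to 0 and T to r. *)
Definition quad_der (r x : quad) : quad := (x.2 * r.1, x.2 * r.2).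

(* The condition (2 T - al) r = 0 under which [quad_der r] is a derivation. *)
Definition quad_der_cond (r : quad) : Prop :=
  be * r.2 *+ 2 = al * r.1 /\ r.1 *+ 2 + al * r.2 = 0.

Lemma quad_derD r : {morph quad_der r : x y / x + y}.
Proof. by move=> x y; congr pair => /=; ring. Qed.

(** The defect of the Leibniz rule at x, y is x.2 y.2 times (2 T - al) r, up to sign. *)
Lemma quad_derM r : quad_der_cond r ->
  forall x y, quad_der r (x * y) = x * quad_der r y + quad_der r x * y.
Proof.
case: r => r0 r1 [/= H1 H2] x y; congr pair => /=.
  transitivity (x.1 * (y.2 * r0) + y.1 * (x.2 * r0) + x.2 * y.2 * (al * r0)).
    by ring.
  by rewrite -H1; ring.
apply/eqP; rewrite -subr_eq0 -oppr_eq0; apply/eqP.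
transitivity (x.2 * y.2 * (r0 *+ 2 + al * r1)); first by ring.
by rewrite H2 mulr0.
Qed.

(** Both sides equal x.2 y.2 r w. *)
Lemma quad_der_wedge r w x y :
  quad_der r x * quad_der w y = quad_der r y * quad_der w x.
Proof. by congr pair => /=; ring. Qed.

(** The two composites send T to w.2 r and r.2 w; the second coordinates of these agree anyway, the
    first ones by hypothesis. *)
Lemma quad_derC r w x : w.2 * r.1 = r.2 * w.1 ->
  quad_der r (quad_der w x) = quad_der w (quad_der r x).
Proof.
case: r w => [r0 r1] [w0 w1] /= H.
by congr pair => /=; rewrite -!mulrA ?H //; ring.
Qed.

Definition quad_map (dl : F -> F) (x : quad) : quad := (dl x.1, dl x.2).

End QuadraticExtension.

(** * Bases and linear maps in dimension two *)

Section Frames.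
Variables (k : fieldType) (V : vectType k).
Implicit Types e f v : V.

Lemma free_pair e f : e != 0 -> f \notin <[e]>%VS -> free [:: e; f].
Proof.
move=> e0 fe; rewrite (perm_free (Y := [:: f; e])) 1?perm_sym; last first.
  by apply/permP => P /=; rewrite !addn0 addnC.
by rewrite free_cons span_seq1 fe seq1_free.
Qed.

Lemma free_pair_coef e f (x y x' y' : k) : free [:: e; f] ->
  x *: e + y *: f = x' *: e + y' *: f -> x = x' /\ y = y'.
Proof.
move=> /freeP fr /eqP; rewrite -subr_eq0 opprD addrACA => /eqP H.
have := fr (fun i : 'I_2 => if i == 0 then x - x' else y - y').
rewrite big_ord_recl big_ord1 /= !scalerBl => /(_ H) z.
by split; apply/eqP; rewrite -subr_eq0; apply/eqP;
  [exact: (z 0) | exact: (z 1)].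
Qed.

Lemma basis_pair_dec e f : basis_of fullv [tuple e; f] ->
  forall v, exists x y, v = x *: e + y *: f.
Proof.
move=> B v; exists (coord [tuple e; f] 0 v), (coord [tuple e; f] 1 v).
rewrite {1}(coord_basis B (memvf v)) big_ord_recl big_ord1 /=.
by have -> : lift ord0 ord0 = 1 :> 'I_2 by apply: val_inj.
Qed.

Hypothesis dimV : \dim {: V} = 2%N.

Lemma free_pair_basis e f : free [:: e; f] -> basis_of fullv [tuple e; f].
Proof. by move=> fr; rewrite basisEfree fr subvf dimV. Qed.

Lemma exists_free_pair : exists e f, free [:: e; f].
Proof.
have := vbasisP {: V}; move: (vbasis _); rewrite dimV => X B.
exists X`_0, X`_1; have <- : X = [:: X`_0; X`_1] :> seq V.
  by case: X B => -[|e [|f [|g s]]].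
exact: basis_free B.
Qed.

(** If x, y and x + y are all eigenvectors for a basis x, y, then their eigenvalues coincide. *)
Lemma scalar_linear_dichotomy (g : {linear V -> V}) :
  (exists v, g v \notin <[v]>%VS) \/ (exists c, forall v, g v = c *: v).
Proof.
have [x [y fr]] := exists_free_pair.
have [|] := boolP (g x \in <[x]>%VS); last by left; exists x.
have [|] := boolP (g y \in <[y]>%VS); last by left; exists y.
have [|] := boolP (g (x + y) \in <[x + y]>%VS); last by left; exists (x + y).
move=> /vlineP[c gxy] /vlineP[b gy] /vlineP[a gx]; right; exists a => v.
move: gxy; rewrite linearD gx gy scalerDr => /(free_pair_coef fr)[ac bc].
have [p [q ->]] := basis_pair_dec (free_pair_basis fr) v.
by rewrite linearD !linearZ /= gx gy bc -ac scalerDr !scalerA ![a * _]mulrC.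
Qed.

End Frames.

Lemma linear_mul_ext (k : fieldType) (V W : lmodType k)
    (mV : {bilinear V -> V -> V}) (mW : {bilinear W -> W -> W})
    (phi : {linear V -> W}) (e f : V) :
    (forall v, exists x y, v = x *: e + y *: f) ->
    phi (mV e e) = mW (phi e) (phi e) -> phi (mV e f) = mW (phi e) (phi f) ->
    phi (mV f e) = mW (phi f) (phi e) -> phi (mV f f) = mW (phi f) (phi f) ->
  forall v w, phi (mV v w) = mW (phi v) (phi w).
Proof.
move=> dec ee ef fe ff v w; have [x [y ->]] := dec v.
have [x' [y' ->]] := dec w.
rewrite [phi (x *: _ + _)]linearD [phi (x' *: _ + _)]linearD !linearZ /=.
rewrite !linearDl !linearZl_LR /= !linearDr !linearZr_LR /=.
do 2!rewrite ![phi (_ + _)]linearD ![phi (_ *: _)]linearZ /=.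
by rewrite ee ef fe ff.
Qed.

(* V is C e for C = k[T] / (T^2 - al T - be), with f = T e and the operations
   (x e) o (y e) = x (d y + s y) e, [x e, y e] = (D x * y - x * D y) e, where
   d and D are the commuting derivations of C with d T = r and D T = w. *)
Record quad_form (k : fieldType) (V : lmodType k) (A : gd_algebra V) (e f : V)
    (al be s0 s1 r0 r1 w0 w1 : k) : Prop := QuadForm {
  qf_ee : gd_circ A e e = s0 *: e + s1 *: f;
  qf_ef : gd_circ A e f = (r0 + be * s1) *: e + (r1 + s0 + al * s1) *: f;
  qf_fe : gd_circ A f e = (be * s1) *: e + (s0 + al * s1) *: f;
  qf_ff : gd_circ A f f = (be * (r1 + s0 + al * s1)) *: e
             + (r0 + be * s1 + al * (r1 + s0 + al * s1)) *: f;
  qf_br : gd_br A f e = w0 *: e + w1 *: f;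
  qf_r : quad_der_cond ((r0, r1) : quad al be);
  qf_w : quad_der_cond ((w0, w1) : quad al be);
  qf_rw : w1 * r0 = r1 * w0
}.

(** * Embedding of an algebra in quadratic form *)

Section QuadFormSpecial.
Variables (k : fieldType) (V : vectType k) (A : gd_algebra V) (e f : V).
Variables (al be s0 s1 r0 r1 w0 w1 : k).
Hypothesis basis_ef : basis_of fullv [tuple e; f].
Hypothesis qf : quad_form A e f al be s0 s1 r0 r1 w0 w1.
(** Abstract form of k(t) with d/dt: constants come from [j], and [t] is invertible with inverse
    [u]. *)
Variables (F : comNzRingType) (j : {rmorphism k -> F}) (dF : F -> F) (t u : F).
Hypotheses (dFD : {morph dF : x y / x + y})
  (dFM : forall x y, dF (x * y) = x * dF y + dF x * y)
  (dFj : forall a, dF (j a) = 0) (dFt : dF t = 1) (tu1 : t * u = 1).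

Local Notation P := (quad (j al) (j be)).

Lemma derF0 : dF 0 = 0. Proof. by have := dFj 0; rewrite rmorph0. Qed.

Lemma derF_inv : dF u = - u ^+ 2.
Proof.
have : dF (t * u) = 0 by rewrite tu1 -(rmorph1 j) dFj.
rewrite dFM dFt mul1r => /(congr1 ( *%R u)).
rewrite mulrDr mulrA [u * t]mulrC tu1 mul1r mulr0 -expr2 => /eqP.
by rewrite addr_eq0 => /eqP.
Qed.

Definition quad_scalar : k -> P := quad_const (j al) (j be) \o j.
HB.instance Definition _ := GRing.RMorphism.on quad_scalar.

Let jpair (x y : k) : P := (j x, j y).

Lemma quad_map_derivation : is_derivation quad_scalar (quad_map dF : P -> P).
Proof.
split=> [x y|x y|a]; rewrite /quad_map.
- by congr pair; rewrite /= dFD.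
- by congr pair; rewrite /= !(dFD, dFM) dFj; ring.
- by rewrite /= dFj derF0.
Qed.

Lemma quad_der_cond_rmorph x y : quad_der_cond ((x, y) : quad al be) ->
  quad_der_cond (jpair x y).
Proof.
case=> /= H1 H2; split.
  by rewrite /= -!rmorphM -!rmorphMn /= H1.
by rewrite /= -!rmorphM -!rmorphMn -rmorphD /= H2 rmorph0.
Qed.

Lemma quad_der_derivation x y : quad_der_cond ((x, y) : quad al be) ->
  is_derivation quad_scalar (quad_der (jpair x y)).
Proof.
move=> xy; split; first exact: quad_derD.
- exact/quad_derM/quad_der_cond_rmorph.
- by move=> a; rewrite /quad_der /= !mul0r.
Qed.

Lemma quad_map_der x y z :
  quad_map dF (quad_der (jpair x y) z) = quad_der (jpair x y) (quad_map dF z).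
Proof. by congr pair; rewrite /= dFM dFj; ring. Qed.

Lemma quad_der_comm z : quad_der (jpair r0 r1) (quad_der (jpair w0 w1) z)
  = quad_der (jpair w0 w1) (quad_der (jpair r0 r1) z).
Proof. by apply: quad_derC; rewrite /= -!rmorphM (qf_rw qf). Qed.

Lemma quad_map_jpair x y : quad_map dF (jpair x y) = 0.
Proof. by rewrite /quad_map /= !dFj. Qed.

Lemma quad_map_const x :
  quad_map dF (quad_const (j al) (j be) x) = quad_const _ _ (dF x).
Proof. by congr pair; rewrite /= derF0. Qed.

Lemma quad_map_inv :
  quad_map dF (quad_const (j al) (j be) u) = - quad_const _ _ u ^+ 2.
Proof. by rewrite quad_map_const derF_inv rmorphN rmorphXn. Qed.

Lemma quad_der_const x y z : quad_der (jpair x y) (quad_const _ _ z) = 0.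
Proof. by rewrite /quad_der /= !mul0r. Qed.

(** Here d/dt acts on coefficients, d T = r, D T = w, s = s0 + s1 T and u = 1/t. *)
Let D := der_diff_poisson quad_map_derivation
  (quad_der_derivation (qf_r qf)) (quad_der_derivation (qf_w qf))
  (quad_map_der r0 r1) (quad_map_der w0 w1) quad_der_comm
  (@quad_der_wedge _ _ _ (jpair r0 r1) (jpair w0 w1))
  (quad_map_jpair s0 s1) quad_map_inv (quad_der_const w0 w1 u).

Local Notation Q := (scalar_restr quad_scalar).
Let E : Q := ((t, 0) : P).
Let G : Q := ((0, t) : P).

Definition quad_embed (v : V) : Q :=
  coord [tuple e; f] 0 v *: E + coord [tuple e; f] 1 v *: G.

Fact quad_embed_linear : linear quad_embed.
Proof.
move=> a x y.
rewrite /quad_embed ![coord _ _ (_ + _)]linearP /= !scalerDl !scalerDr !scalerA.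
by rewrite addrACA.
Qed.

HB.instance Definition _ :=
  GRing.isLinear.Build k V Q _ quad_embed quad_embed_linear.

Lemma quad_embedE v : quad_embed v =
  (j (coord [tuple e; f] 0 v) * t, j (coord [tuple e; f] 1 v) * t) :> P.
Proof. by rewrite /quad_embed !restr_scaleE; congr pair => /=; ring. Qed.

Lemma quad_embed_inj : injective quad_embed.
Proof.
apply: raddf_inj => v /= v0.
have jt0 x : j x * t = 0 -> x = 0.
  move=> /(congr1 ( *%R^~ u)); rewrite -mulrA tu1 mulr1 mul0r => /eqP.
  by rewrite fmorph_eq0 => /eqP.
have := quad_embedE v; rewrite v0 => vE.
have /esym/jt0 x0 := congr1 fst vE; have /esym/jt0 y0 := congr1 snd vE.
rewrite (coord_basis basis_ef (memvf v)) big_ord_recl big_ord1 /=.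
have -> : lift ord0 ord0 = 1 :> 'I_2 by apply: val_inj.
by rewrite x0 y0 !scale0r addr0.
Qed.

Lemma quad_embed_comb x y :
  quad_embed (x *: e + y *: f) = (j x * t, j y * t) :> P.
Proof.
have free := basis_free basis_ef.
have c00 : coord [tuple e; f] 0 e = 1 by rewrite (coord_free 0 0 free).
have c01 : coord [tuple e; f] 0 f = 0 by rewrite (coord_free 1 0 free).
have c10 : coord [tuple e; f] 1 e = 0 by rewrite (coord_free 0 1 free).
have c11 : coord [tuple e; f] 1 f = 1 by rewrite (coord_free 1 1 free).
rewrite quad_embedE !linearD !linearZ /= c00 c01 c10 c11.
by rewrite !mulr1 !mulr0 addr0 add0r.
Qed.

Lemma quad_embed_e : quad_embed e = (t, 0) :> P.
Proof.
have := quad_embed_comb 1 0.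
by rewrite scale1r scale0r addr0 rmorph1 rmorph0 mul1r mul0r.
Qed.

Lemma quad_embed_f : quad_embed f = (0, t) :> P.
Proof.
have := quad_embed_comb 0 1.
by rewrite scale1r scale0r add0r rmorph1 rmorph0 mul1r mul0r.
Qed.

(** Holds by conversion; typing it in [P] exposes the pair components on which [ring] works. *)
Lemma quad_circE (x y : P) : gd_circ (gd_of_diff_poisson D) x y =
  x * (jpair s0 s1 * quad_map dF y
       + quad_const (j al) (j be) u * quad_der (jpair r0 r1) y) :> P.
Proof. by []. Qed.

Lemma quad_brE (x y : P) : gd_br (gd_of_diff_poisson D) x y =
  quad_der (jpair w0 w1) x * quad_map dF y
  - quad_map dF x * quad_der (jpair w0 w1) y :> P.
Proof. by []. Qed.

(** For x, y constant in t, (s d/dt + u d)(y t) = s y + d y because u t = 1, and {x t, y t} = (D x *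
    y - x * D y) t. This is checked on the basis e, f. *)
Lemma quad_embed_hom : is_gd_hom A (gd_of_diff_poisson D) quad_embed.
Proof.
have tu1' x : t * (u * x) = x by rewrite mulrA tu1 mul1r.
have [br_alt _] := gd_lie A.
have br_ef : gd_br A e f = (- w0) *: e + (- w1) *: f.
  apply/eqP; rewrite !scaleNr -opprD -(qf_br qf) -addr_eq0; apply/eqP.
  by have := br_alt (e + f); rewrite linearDl !linearDr /= !br_alt add0r addr0.
(* Written as a combination of e and f so that [quad_embed_comb] applies to [e, e] and [f, f]. *)
have zero : 0 = 0 *: e + 0 *: f by rewrite !scale0r addr0.
split.
  apply: (@linear_mul_ext _ _ _ (gd_circ A) (gd_circ (gd_of_diff_poisson D))
            quad_embed e f (basis_pair_dec basis_ef)); rewrite /=.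
  - rewrite (qf_ee qf) quad_embed_comb quad_embed_e quad_circE.
  congr pair; rewrite /= ?dFt ?derF0; ring: tu1.
  - rewrite (qf_ef qf) quad_embed_comb quad_embed_e quad_embed_f quad_circE.
  congr pair; rewrite /= ?dFt ?derF0; ring: tu1.
  - rewrite (qf_fe qf) quad_embed_comb quad_embed_e quad_embed_f quad_circE.
  congr pair; rewrite /= ?dFt ?derF0; ring: tu1.
  - rewrite (qf_ff qf) quad_embed_comb quad_embed_f quad_circE.
  congr pair; rewrite /= ?dFt ?derF0; ring: tu1.
apply: (@linear_mul_ext _ _ _ (gd_br A) (gd_br (gd_of_diff_poisson D))
            quad_embed e f (basis_pair_dec basis_ef)); rewrite /=.
- rewrite br_alt zero quad_embed_comb quad_embed_e quad_brE.
  congr pair; rewrite /= ?dFt ?derF0; ring: tu1.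
- rewrite br_ef quad_embed_comb quad_embed_e quad_embed_f quad_brE.
  congr pair; rewrite /= ?dFt ?derF0; ring: tu1.
- rewrite (qf_br qf) quad_embed_comb quad_embed_e quad_embed_f quad_brE.
  congr pair; rewrite /= ?dFt ?derF0; ring: tu1.
- rewrite br_alt zero quad_embed_comb quad_embed_f quad_brE.
  congr pair; rewrite /= ?dFt ?derF0; ring: tu1.
Qed.

Lemma quad_form_special_over : special A.
Proof.
exists Q, D, quad_embed.
by split; [exact: quad_embed_hom | exact: quad_embed_inj].
Qed.

End QuadFormSpecial.

Lemma quad_form_special (k : fieldType) (V : vectType k) (A : gd_algebra V)
    (e f : V) (al be s0 s1 r0 r1 w0 w1 : k) :
  basis_of fullv [tuple e; f] -> quad_form A e f al be s0 s1 r0 r1 w0 w1 ->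
  special A.
Proof.
move=> basis_ef qf.
(* The ring F becomes k(t), with [j] the inclusion of constants. *)
pose j : {rmorphism k -> {fraction {poly k}}} :=
  (@FracField.tofrac {poly k} \o @polyC k).
have jD a : frac_der (j a) = 0 by rewrite /j /= frac_der_poly derivC tofrac0.
have tD : frac_der ('X : {poly k})%:F = 1.
  by rewrite frac_der_poly derivX tofrac1.
have tV : ('X : {poly k})%:F / ('X : {poly k})%:F = 1.
  by apply: mulfV; rewrite tofrac_eq0 polyX_eq0.
have frac_derM' (x y : {fraction {poly k}}) :
    frac_der (x * y) = x * frac_der y + frac_der x * y.
  by rewrite frac_derM addrC.
exact: (quad_form_special_over basis_ef qf (@frac_derD k) frac_derM' jD tD tV).
Qed.

(** * Reduction of two-dimensional algebras to quadratic form *)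

Section NormalForm.
Variables (k : fieldType) (V : vectType k) (A : gd_algebra V).
Hypothesis dimV : \dim {: V} = 2%N.
Local Notation circ := (gd_circ A).
Local Notation br := (gd_br A).

Lemma gd_br_anti x y : br x y = - br y x.
Proof.
have [alt _] := gd_lie A; apply/eqP; rewrite -addr_eq0; apply/eqP.
by have := alt (x + y); rewrite linearDl !linearDr /= !alt add0r addr0 addrC.
Qed.

(** Here T^2 = 0, d T = - s T and D T = c T; the value of d T is dictated by e o f = (d T + s T) e =
    0. *)
Lemma quad_form_scalar e f (s c : k) :
    (forall a, circ a e = s *: a) -> (forall a, circ a f = 0) ->
    br f e = c *: f -> quad_form A e f 0 0 s 0 0 (- s) 0 c.
Proof.
move=> ce cf bfe.
by split; rewrite ?ce ?cf ?bfe /quad_der_cond /=;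
  rewrite ?(mul0r, mulr0, add0r, addr0, addNr, scale0r, mul0rn).
Qed.

Lemma special_scalar (x y : V) (p q : k) : free [:: x; y] ->
    (forall a, circ a x = p *: a) -> (forall a, circ a y = q *: a) ->
  special A.
Proof.
move=> fr cx cy; have [alt _] := gd_lie A.
have [z0 [z1 zE]] := basis_pair_dec (free_pair_basis dimV fr) (br x y).
have x0 : x != 0.
  by move: fr; rewrite free_cons; case: eqP => // ->; rewrite mem0v.
(* Let phi be the linear form with a o b = phi(b) a, so phi(x) = p and phi(y) = q. Compatibility at
   x, x, y gives x o [x, y] = 0, hence phi([x, y]) = 0. *)
have zphi : z0 * p + z1 * q = 0.
  have := gd_compat A x x y.
  rewrite !cx !cy !linearZr_LR /= !alt !scaler0 addr0 sub0r.
  rewrite (gd_br_anti y x) scalerN opprK subrr zE linearD !linearZ /= cx cy.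
  rewrite !scalerA -scalerDl => /eqP; rewrite scaler_eq0 (negPf x0) orbF.
  by move=> /eqP.
(* A nonzero f in ker phi whose line contains [x, y]: take [x, y] itself if nonzero, otherwise q x -
   p y, or x when phi = 0. *)
have [f0 [f1 [c [f_neq0 fphi zf]]]] : exists f0 f1 c : k,
    [/\ (f0 != 0) || (f1 != 0), f0 * p + f1 * q = 0
      & br x y = c *: (f0 *: x + f1 *: y)].
  have [z_neq0|] := boolP ((z0 != 0) || (z1 != 0)).
    by exists z0, z1, 1; rewrite scale1r.
  rewrite negb_or !negbK => /andP[/eqP z00 /eqP z10].
  have [pq_neq0|] := boolP ((q != 0) || (- p != 0)).
    exists q, (- p), 0; split=> //; first by ring.
    by rewrite zE z00 z10 !scale0r addr0.
  rewrite negb_or !negbK oppr_eq0 => /andP[/eqP q0 /eqP p0].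
  exists 1, 0, 0; rewrite oner_eq0 p0 q0 zE z00 z10 !scale0r addr0.
  by split=> //; ring.
have cf a : circ a (f0 *: x + f1 *: y) = 0.
  by rewrite linearD !linearZ /= cx cy !scalerA -scalerDl fphi scale0r.
have bfx : br (f0 *: x + f1 *: y) x = (- f1 * c) *: (f0 *: x + f1 *: y).
  by rewrite linearDl !linearZl_LR /= alt scaler0 add0r gd_br_anti zf
    scalerN scalerA mulNr scaleNr.
have bfy : br (f0 *: x + f1 *: y) y = (f0 * c) *: (f0 *: x + f1 *: y).
  by rewrite linearDl !linearZl_LR /= alt scaler0 addr0 zf scalerA.
(* Whichever of x, y is independent of f serves as e. *)
have [f10|f10] := eqVneq f1 0; last first.
  apply: quad_form_special (quad_form_scalar cx cf bfx).
  apply: (free_pair_basis dimV); apply: free_pair => //; apply/vlineP => -[a].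
  rewrite -[RHS]addr0 -[X in _ = _ + X](scale0r y)
    => /(free_pair_coef fr)[_ /eqP].
  by rewrite (negPf f10).
have f00 : f0 != 0 by move: f_neq0; rewrite f10 eqxx orbF.
apply: quad_form_special (quad_form_scalar cy cf bfy).
apply: (free_pair_basis dimV); apply: free_pair.
  by move: fr; rewrite free_cons seq1_free => /andP[].
apply/vlineP => -[a].
rewrite -[RHS]add0r -[X in _ = X + _](scale0r x) => /(free_pair_coef fr)[/eqP].
by rewrite (negPf f00).
Qed.

(** The quantities [n0] and [n1] below are the coordinates of (2 T - al) w, and w1 r0 - r1 w0 is the
    obstruction to commutation. If s1 is nonzero, they vanish in the order [n1], obstruction, [n0];
    if s1 = 0, the obstruction vanishes first and q cancels from the rest. *)
Lemma quad_constraints (al be s1 q r0 r1 w0 w1 : k) :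
    (s1 != 0) || (q != 0) ->
    w1 * r0 - r1 * w0 + s1 * (be * w1 *+ 2 - al * w0) = 0 ->
    s1 * (w0 *+ 2 + al * w1) = 0 ->
    q * (be * w1 *+ 2 - al * w0) = 0 ->
    q * (w0 *+ 2 + al * w1) + (w1 * r0 - r1 * w0) = 0 ->
  quad_der_cond ((w0, w1) : quad al be) /\ w1 * r0 = r1 * w0.
Proof.
set n0 := be * w1 *+ 2 - al * w0; set n1 := w0 *+ 2 + al * w1.
move=> sq E1 E2 E3 E4.
suff [n00 n10] : n0 = 0 /\ n1 = 0.
  split; first by split=> //=; apply/eqP; rewrite -subr_eq0; apply/eqP.
  by move: E4; rewrite n10 mulr0 add0r => /eqP; rewrite subr_eq0 => /eqP.
have [s10|s10] := eqVneq s1 0.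
  have q0 : q != 0 by move: sq; rewrite s10 eqxx.
  move: E1; rewrite s10 mul0r addr0 => E1; move: E4; rewrite E1 addr0 => /eqP.
  move/eqP: E3; rewrite !mulf_eq0 (negPf q0) /= => /eqP -> /eqP ->.
  by [].
have n10 : n1 = 0 by move/eqP: E2; rewrite mulf_eq0 (negPf s10) => /eqP.
move: E4; rewrite n10 mulr0 add0r => E4; move: E1; rewrite E4 add0r => /eqP.
by rewrite mulf_eq0 (negPf s10) => /eqP.
Qed.

Lemma special_cyclic (e v : V) : circ e v \notin <[e]>%VS -> special A.
Proof.
have [novl novr] := gd_novikov A; have [alt _] := gd_lie A.
have [f ev] : exists f, circ e v = f by exists (circ e v).
rewrite ev => fe.
have e0 : e != 0.
  by apply: contraNneq fe => e0; rewrite -ev e0 linear0l mem0v.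
have fr := free_pair e0 fe.
have dec := basis_pair_dec (free_pair_basis dimV fr).
(* With T the right multiplication by v and f = T e, the coordinates of f o v encode T^2 = al T +
   be, and those of e o e encode s. *)
have [s0 [s1 ee]] := dec (circ e e); have [p [q ef]] := dec (circ e f).
have [be [al fv]] := dec (circ f v); have [w0 [w1 bfe]] := dec (br f e).
have [v0 [v1 vE]] := dec v.
pose m x y : V := x *: e + y *: f.
have mD x y x' y' : m x y + m x' y' = m (x + x') (y + y').
  by rewrite /m !scalerDl addrACA.
have mZ a x y : a *: m x y = m (a * x) (a * y) by rewrite /m scalerDr !scalerA.
have mN x y : - m x y = m (- x) (- y) by rewrite /m !scaleNr opprD.
have m_inj x y x' y' : m x y = m x' y' -> x = x' /\ y = y'.
  exact: free_pair_coef.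
have mf : f = m 0 1 by rewrite /m scale1r scale0r add0r.
have mr (h : {bilinear V -> V -> V}) x y z :
    h z (m x y) = x *: h z e + y *: h z f.
  by rewrite /m linearDr !linearZr_LR.
have ml (h : {bilinear V -> V -> V}) x y z :
    h (m x y) z = x *: h e z + y *: h f z.
  by rewrite /m linearDl !linearZl_LR.
rewrite -!/(m _ _) in ee ef fv bfe vE.
have mE := (mZ, mN, mD).
(* Right commutativity: (e o v) o e = (e o e) o v, that is, T applied to e o e; likewise for f o
   f. *)
have fe' : circ f e = m (be * s1) (s0 + al * s1).
  by rewrite -{1}ev novr ee ml ev fv {1}mf !mE; congr m; ring.
have ff : circ f f = m (be * q) (p + al * q).
  by rewrite -{1}ev novr ef ml ev fv {1}mf !mE; congr m; ring.
have bef : br e f = m (- w0) (- w1) by rewrite gd_br_anti bfe mN.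
(* The f-coordinate of e o v = f reads v0 s1 + v1 q = 1, so s1 and q are not both zero. *)
have := ev; rewrite {1}vE mr ee ef {1}mf !mE => /m_inj[_ sq].
(* Left symmetry at e, f, v yields (2 T - al) r = 0, the condition for d to be a derivation. *)
have := novl e f v.
rewrite ev fv ef fe' !ml mr ev fv ee ef ff {1 2}mf !mE => /m_inj[R0 R1].
(* This instance of compatibility and the next give the four equations of [quad_constraints]. *)
have := gd_compat A f e e.
rewrite !alt linear0l subr0 bfe ee ef bef !mr ml ee ef fe' bfe bef !alt.
rewrite !scaler0 !(add0r, addr0) !mE => /m_inj[B0 B1].
have := gd_compat A f f e.
rewrite !alt linear0l addr0 bfe ff fe' !mr !ml ef ff fe' bfe bef !alt.
rewrite !scaler0 !(add0r, addr0) !mE => /m_inj[C0 C1].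
(* Solves e o f = (d T + s T) e for r = d T. *)
pose r0 := p - be * s1; pose r1 := q - s0 - al * s1.
have pE : p = r0 + be * s1 by rewrite /r0; ring.
have qE : q = r1 + s0 + al * s1 by rewrite /r1; ring.
have sq0 : (s1 != 0) || (q != 0).
  rewrite -negb_and; apply: contra_eqN sq => /andP[/eqP-> /eqP->].
  by rewrite !mulr0 addr0 eq_sym oner_eq0.
have diff (x y z : k) : x = y -> z = x - y -> z = 0 by move=> ->; rewrite subrr.
have [|||||wP rw] := @quad_constraints al be s1 q r0 r1 w0 w1 => //.
- by apply: diff B0 _; rewrite pE qE; ring.
- by apply: diff B1 _; rewrite qE; ring.
- by apply: diff C0 _; ring.
- by apply: diff C1 _; rewrite pE qE; ring.
apply: (quad_form_special (free_pair_basis dimV fr)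
  (al := al) (be := be) (s0 := s0) (s1 := s1) (r0 := r0) (r1 := r1)
  (w0 := w0) (w1 := w1)).
split=> //; rewrite -?pE -?qE //; split=> /=.
- apply/eqP; rewrite -subr_eq0; apply/eqP.
  by apply: diff R0 _; rewrite pE qE; ring.
- by apply: diff R1 _; rewrite pE qE; ring.
Qed.

End NormalForm.

Theorem theorem2 (k : fieldType) (V : vectType k) (A : gd_algebra V)
    (dimV : \dim {: V} = 2%N) : special A.
Proof.
have [x [y fr]] := exists_free_pair dimV.
(* Here [applyr] gives right multiplication by x; a vector it moves off its own line serves as the
   cyclic generator e. *)
have [[v xv]|[p cx]] := scalar_linear_dichotomy dimV (applyr (gd_circ A) x).
  exact: special_cyclic xv.
have [[v yv]|[q cy]] := scalar_linear_dichotomy dimV (applyr (gd_circ A) y).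
  exact: special_cyclic yv.
exact: special_scalar fr cx cy.
Qed.
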